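(* Let $G=(V,E,w)$ be a weighted hypergraph with $E\neq\varnothing$ and with connected components $S_1,\dots,S_l$; let $p\in[1,\infty)$, $T>0$, $x_0\in\mathbb{R}^V$. Let $x$ be the solution of $$\frac{d}{dt}x(t)+L_{G,p}(x(t))\ni 0\quad(t\in(0,T)),\qquad x(0)=x_0,$$ and put $X(t):=|x(t)-\overline{x_0}|_{\ell^2}^2$ and $$C_{G,p}:=\frac{1}{\min_{e\in E}w(e)}\left(\sum_{j=1}^{l}(\#S_j)^{2-\frac1p}\right)^p .$$ Then for all $t\in[0,T]$: $$X(t)\le\left(X(0)^{\frac{2-p}{2}}-\frac{(2-p)t}{C_{G,p}}\right)_+^{\frac{2}{2-p}}\quad\text{if }1\le p<2,$$ $$X(t)\le X(0)\exp\left(-\frac{2t}{C_{G,p}}\right)\quad\text{if }p=2,$$ $$X(t)\le\left(X(0)^{-\frac{p-2}{2}}+\frac{(p-2)t}{C_{G,p}}\right)^{-\frac{2}{p-2}}\quad\text{if }p>2,$$ where $(s)_+:=\max\{s,0\}$, and where for $p>2$ the right-hand side is understood as $0$ if $X(0)=0$.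
   Context: A weighted hypergraph $G=(V,E,w)$ consists of a finite set $V=\{v_1,\dots,v_n\}$, a set $E\subset 2^V$ of hyperedges, each $e\in E$ containing more than one element of $V$, and a weight function $w:E\to(0,\infty)$. $\mathbb{R}^V$ is the space of functions $x:V\to\mathbb{R}$ with inner product $x\cdot y=\sum_{v\in V}x(v)y(v)$ and norm $|x|_{\ell^2}=(x\cdot x)^{1/2}$. For $S\subset V$, $1_S\in\mathbb{R}^V$ is the indicator function of $S$, $1_v:=1_{\{v\}}$, and $\#S$ is the number of elements of $S$. For $e\in E$ let $B_e:=\operatorname{conv}\{1_u-1_v:\ u,v\in e\}$ and $f_e(x):=\max_{u,v\in e}(x(u)-x(v))=\max_{b\in B_e}b\cdot x$. For $p\in[1,\infty)$ define $\varphi_{G,p}(x):=\frac1p\sum_{e\in E}w(e)(f_e(x))^p$, and let the hypergraph $p$-Laplacian be its (multivalued) subdifferential $$L_{G,p}(x):=\partial\varphi_{G,p}(x)=\Big\{\sum_{e\in E}w(e)(f_e(x))^{p-1}b_e:\ b_e\in\operatorname{argmax}_{b\in B_e}b\cdot x\Big\}.$$ (When $p=1$, the factor $(f_e(x))^{p-1}$ is $1$.) Connected components: $S_1,\dots,S_l$ are the equivalence classes of $V$ under the relation: $u\sim v$ iff $u=v$ or there are $u_0=u,u_1,\dots,u_k=v$ in $V$ and $e_1,\dots,e_k\in E$ with $u_{j-1},u_j\in e_j$ for all $j=1,\dots,k$. For $x\in\mathbb{R}^V$, $\overline{x}:=\sum_{k=1}^l c_k1_{S_k}$ with $c_k=\frac{1}{\#S_k}\sum_{v\in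 S_k}x(v)$. The solution of the Cauchy problem is the unique $x\in W^{1,2}(0,T;\mathbb{R}^V)$ (absolutely continuous on $[0,T]$) with $x(0)=x_0$ satisfying the inclusion for a.e. $t\in(0,T)$. *)

(* Defs.v *)
From HB Require Import structures.
From mathcomp Require Import all_boot all_order all_algebra.
From mathcomp Require Import all_classical all_reals all_analysis.

Set Implicit Arguments.
Unset Strict Implicit.
Unset Printing Implicit Defensive.

Import Order.TTheory GRing.Theory Num.Theory.
Import numFieldNormedType.Exports.
Local Open Scope classical_set_scope.
Local Open Scope ring_scope.

(* [weight] is total on {set V} for convenience; only its values on [edges]
   are ever used. *)
Record weighted_hypergraph (R : realType) (V : finType) := WeightedHypergraph {
  edges : {set {set V}};
  weight : {set V} -> R;
  edges_gt1 : forall e, e \in edges -> (1 < #|e|)%N;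
  weight_gt0 : forall e, e \in edges -> 0 < weight e
}.

Section Euclidean.
Context {R : realType} {V : finType}.
Implicit Types x y : V -> R.

Definition dotp x y : R := \sum_(v : V) x v * y v.

Definition l2norm x : R := Num.sqrt (dotp x x).

Definition subdifferential (phi : (V -> R) -> R) x : set (V -> R) :=
  [set z | forall y, phi x + dotp z (fun v => y v - x v) <= phi y].

End Euclidean.

Section Hypergraph.
Context {R : realType} {V : finType}.
Variable G : weighted_hypergraph R V.
Implicit Types (e S : {set V}) (x : V -> R).

(* max_(u, v in e) (x u - x v); the default value 0 does not affect the maximum
   of a nonempty edge, since u = v is allowed. *)
Definition edge_max e x : R :=
  \big[Num.max/0]_(u in e) \big[Num.max/0]_(v in e) (x u - x v).

Definition energy (p : R) x : R :=
  p^-1 * \sum_(e in edges G) weight G e * edge_max e x `^ p.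

Definition pLaplacian (p : R) x : set (V -> R) :=
  subdifferential (energy p) x.

Definition share_edge : rel V :=
  fun u v => [exists e in edges G, (u \in e) && (v \in e)].

Definition components : {set {set V}} :=
  equivalence_partition (connect share_edge) [set: V].

Definition mean S x : R := #|S|%:R^-1 * \sum_(v in S) x v.

Definition component_mean x : V -> R :=
  fun v => \sum_(S in components) mean S x * (v \in S)%:R.

(* The infimum of a finite set, nonempty as soon as G has an edge: a minimum. *)
Definition min_weight : R :=
  inf [set weight G e | e in [set` edges G]].

Definition decay_const (p : R) : R :=
  min_weight^-1 * (\sum_(S in components) #|S|%:R `^ (2 - p^-1)) `^ p.

End Hypergraph.

Section Evolution.
Context {R : realType}.
Notation mu := (@lebesgue_measure R).

Definition abs_continuous (a b : R) (f : R -> R) : Prop :=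
  forall eps : R, 0 < eps -> exists2 delta : R, 0 < delta &
    forall (n : nat) (c d : 'I_n -> R),
      (forall i, a <= c i /\ c i <= d i /\ d i <= b) ->
      (forall i j, i != j -> `]c i, d i[ `&` `]c j, d j[ = set0) ->
      \sum_(i < n) (d i - c i) < delta ->
      \sum_(i < n) `|f (d i) - f (c i)| < eps.

(* W^{1,2}(a, b), by absolutely continuous representatives: f is absolutely
   continuous on [a, b] and its a.e. derivative g is in L^2(a, b). *)
Definition sobolev12 (a b : R) (f : R -> R) : Prop :=
  abs_continuous a b f /\
  exists g : R -> R,
    [/\ measurable_fun `]a, b[ g,
        mu.-integrable `]a, b[ (fun t => (g t ^+ 2)%:E) &
        {ae mu, forall t, a < t < b -> is_derive t (1 : R) f (g t)}].

(* R^V-valued functions are treated componentwise, V being finite; x' is the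
   derivative of x at t, and x' + L(x t) contains 0 iff - x' is in L(x t). *)
Definition cauchy_solution (V : finType) (L : (V -> R) -> set (V -> R))
    (T : R) (x0 : V -> R) (x : R -> V -> R) : Prop :=
  [/\ forall v, sobolev12 0 T (fun t => x t v),
      x 0 = x0 &
      {ae mu, forall t, 0 < t < T -> exists x' : V -> R,
        (forall v, is_derive t (1 : R) (fun s => x s v) (x' v)) /\
        L (x t) (fun v => - x' v)}].

End Evolution.

(* Main.v *)
Require Import Defs.
From HB Require Import structures.
From mathcomp Require Import all_boot all_order all_algebra.
From mathcomp Require Import all_classical all_reals all_analysis.
From mathcomp Require Import ring lra.
Set Implicit Arguments.
Unset Strict Implicit.
Unset Printing Implicit Defensive.
Import Order.TTheory GRing.Theory Num.Theory.
Import numFieldNormedType.Exports.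
Local Open Scope classical_set_scope.
Local Open Scope ring_scope.

(** Let m be the component mean of x0 and X t = |x t - m|^2.  Each edge lies in
    one connected component, so adding to x a function that is constant on
    every edge leaves the energy unchanged; every subgradient is therefore
    orthogonal to the indicators of the components
    ([pLaplacian_orthogonal]), and the component means are conserved along the
    flow ([cauchy_solution_mean]).

    For the same reason the energy is p-homogeneous around m, and the
    subgradient inequality along the line through x and m gives Euler's
    identity: z . (x - m) = p * energy x for every subgradient z
    ([pLaplacian_euler]).  Hence X' = - 2 p energy (x t) almost everywhere.

    The energy controls X by a Poincare inequality ([poincare]):
    X ^ (p / 2) <= C * p * energy.  Two vertices of a component S are joined by
    a path that repeats neither a vertex nor an edge, so that it has at most
    #|S| distinct edges; the power mean inequality turns the sum of the edge
    oscillations along it into #|S| ^ (1 - 1 / p) times their l^p norm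
    ([component_osc]).  Summing over the vertices of S contributes the
    remaining factor #|S|.

    Thus X' <= - (2 / C) X ^ (p / 2) almost everywhere, and X is absolutely
    continuous.  As long as X > 0, let H be an antiderivative of
    r ^ (- p / 2), i.e. ln or a multiple of a power; then H (X t) + 2 t / C has
    a nonpositive derivative almost everywhere and is absolutely continuous,
    because H is Lipschitz away from 0, so it does not increase
    ([decay_comparison]).  Solving for X t gives the three estimates.

    Both the conservation of the means and the decay of X rest on one fact of
    real analysis: an absolutely continuous function whose derivative is
    almost everywhere nonpositive does not increase
    ([abs_continuous_nonincreasing]). *)

(** * Absolutely continuous functions *)

Section AbsoluteContinuity.
Context {R : realType}.
Notation mu := (@lebesgue_measure R).
Implicit Types (a b : R) (f g : R -> R).

Lemma abs_continuousS {a b} a' b' {f} : a <= a' -> b' <= b ->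
  abs_continuous a b f -> abs_continuous a' b' f.
Proof.
move=> aa' bb' acf eps eps0; have [delta d0 acd] := acf _ eps0.
exists delta => // n c d cd; apply: acd => i.
by have [? [? ?]] := cd i; split; [|split] => //; lra.
Qed.

Lemma abs_continuousD {a b f g} : abs_continuous a b f ->
  abs_continuous a b g -> abs_continuous a b (fun t => f t + g t).
Proof.
move=> acf acg eps eps0.
have eps20 : 0 < eps / 2 by lra.
have [d1 d10 ac1] := acf _ eps20; have [d2 d20 ac2] := acg _ eps20.
exists (Num.min d1 d2); first by rewrite lt_min d10.
move=> n c d cd dis; rewrite lt_min => /andP[lt1 lt2].
have := ac1 n c d cd dis lt1; have := ac2 n c d cd dis lt2.
set A := \sum_(i < n) _; set B := \sum_(i < n) _ => hA hB.
apply: (@le_lt_trans _ _ (B + A)); last lra.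
rewrite -big_split/=; apply: ler_sum => i _.
rewrite (_ : _ - _ = (f (d i) - f (c i)) + (g (d i) - g (c i))); last ring.
exact: ler_normD.
Qed.

Lemma abs_continuous_lipschitz_comp {a b f} (D : set R) (h : R -> R) (k : R) :
  (forall t, a <= t <= b -> D (f t)) ->
  (forall r s, D r -> D s -> `|h r - h s| <= k * `|r - s|) ->
  abs_continuous a b f -> abs_continuous a b (fun t => h (f t)).
Proof.
move=> Df hlip acf eps eps0.
have k0 : 0 < `|k| + 1 by have := normr_ge0 k; lra.
have [delta d0 acd] := acf _ (divr_gt0 eps0 k0).
exists delta => // n c d cd dis /(acd n c d cd dis).
rewrite ltr_pdivlMr// => lt; apply: le_lt_trans lt.
rewrite mulr_suml; apply: ler_sum => i _.
have [? [? ?]] := cd i.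
have ? : c i <= b by lra.
have ? : a <= d i by lra.
apply: (le_trans (hlip _ _ (Df _ _) (Df _ _))); try by apply/andP.
rewrite mulrC; apply: ler_wpM2l => //; have := ler_norm k; lra.
Qed.

Lemma abs_continuous_linear a b (k : R) : abs_continuous a b (fun t => k * t).
Proof.
apply: (@abs_continuous_lipschitz_comp a b id setT ( *%R k) `|k|) => //.
  by move=> r s _ _; rewrite -mulrBr normrM.
move=> eps eps0; exists eps => // n c d cd _ /le_lt_trans; apply.
by apply: ler_sum => i _; have [? [? ?]] := cd i; rewrite ger0_norm// subr_ge0.
Qed.

Lemma abs_continuous_sum {I : Type} (r : seq I) (P : pred I) a b
    (f : I -> R -> R) :
  (forall i, abs_continuous a b (f i)) ->
  abs_continuous a b (fun t => \sum_(i <- r | P i) f i t).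
Proof.
move=> acf; elim: r => [|i r IHr].
  move=> eps eps0; exists 1 => // n c d _ _ _.
  by rewrite big1// => i _; rewrite !big_nil subrr normr0.
have [Pi|Pi] := boolP (P i); last first.
  by under eq_fun do rewrite big_cons (negbTE Pi).
by under eq_fun do rewrite big_cons Pi; exact: (abs_continuousD (acf i) IHr).
Qed.

Lemma abs_continuous_within {a b f} : abs_continuous a b f ->
  {within `[a, b], continuous f}.
Proof.
move=> acf; apply/subspace_continuousP => x; rewrite /= in_itv/= => /andP[ax xb].
apply/cvgrPdist_lt => eps eps0.
have [delta d0 acd] := acf _ eps0.
have step c d : a <= c -> c <= d -> d <= b -> d - c < delta ->
    `|f d - f c| < eps.
  move=> ac cd db lt.
  have := acd 1%N (fun=> c) (fun=> d); rewrite !big_ord1; apply => //.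
  by move=> i j; rewrite !ord1 eqxx.
rewrite near_withinE; exists delta => //= y /=; rewrite ltr_norml => /andP[h1 h2].
rewrite in_itv/= => /andP[ay yb].
have [xy|yx] := leP x y.
  by rewrite distrC; apply: step => //; lra.
by apply: step => //; lra.
Qed.

Lemma abs_continuous_bounded {a b f} : a <= b -> abs_continuous a b f ->
  exists M, forall t, a <= t <= b -> `|f t| <= M.
Proof.
move=> ab /abs_continuous_within cf.
have [c _ cmax] := EVT_max ab cf; have [d _ dmin] := EVT_min ab cf.
exists (Num.max (f c) (- f d)) => t abt.
have tab : t \in `[a, b]%R by rewrite in_itv.
have := cmax _ tab; have := dmin _ tab => h1 h2.
rewrite ler_norml le_max lerNl le_max; apply/andP; split; apply/orP.
  by right; lra.
by left.
Qed.

Lemma abs_continuous_sqr {a b f} : a <= b -> abs_continuous a b f ->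
  abs_continuous a b (fun t => f t ^+ 2).
Proof.
move=> ab acf; have [M fM] := abs_continuous_bounded ab acf.
apply: (@abs_continuous_lipschitz_comp a b f [set r | `|r| <= M]
  (fun r => r ^+ 2) (2 * M)) => //= r s rM sM.
rewrite subr_sqr normrM mulrC; apply: ler_wpM2r => //.
by apply: (le_trans (ler_normD _ _)); lra.
Qed.

(** The two one-sided inequalities are what a sweep across s needs: it enters
    at a point before s and leaves at a point after s. *)
Lemma is_derive_le_local {f} {s df e : R} : is_derive s 1 f df -> df < e ->
  exists2 r, 0 < r & forall v, `|v - s| < r ->
    (s <= v -> f v - f s <= e * (v - s)) /\
    (v <= s -> f s - f v <= e * (s - v)).
Proof.
move=> [dvf dfE] dfe.
have : (fun h : R => h^-1 *: (f (h *: 1 + s) - f s)) @ 0^' --> df.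
  by move: dvf; rewrite -dfE => /cvg_ex[l] h; rewrite /derive (cvg_lim _ h).
move=> /cvgrPdist_lt /(_ (e - df)); rewrite subr_gt0 => /(_ dfe).
move=> [r /= r0 hr]; exists r => // v vs.
have [->|vneqs] := eqVneq v s; first by split; rewrite !subrr mulr0.
have := hr (v - s); rewrite /= sub0r normrN => /(_ vs).
rewrite subr_eq0 => /(_ vneqs).
rewrite [_ *: 1]mulr1 subrK ltr_norml => /andP[h _].
have q : (v - s)^-1 *: (f v - f s) < e by lra.
move: q; rewrite /GRing.scale/= mulrC.
case: (ltgtP v s) vneqs => // [vls|svl] _; split=> //; rewrite ?leNgt ?vls ?svl//.
  move=> _; move: q; rewrite ltr_ndivrMr ?subr_lt0// => q.
  by rewrite -leNgt; lra.
by rewrite -leNgt; move=> _; move: q; rewrite ltr_pdivrMr ?subr_gt0// => q; lra.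
Qed.

Lemma mu_disjoint_intervals_le n (c d : 'I_n -> R) (U : set R) :
  measurable U -> (forall i, c i <= d i) ->
  (forall i j, i != j -> `]c i, d i[ `&` `]c j, d j[ = set0) ->
  (forall i, `]c i, d i[ `<=` U) ->
  ((\sum_(i < n) (d i - c i))%:E <= mu U)%E.
Proof.
move=> mU cd dis sub.
have mI (i : 'I_n) : measurable (`]c i, d i[%classic : set R).
  exact: measurable_itv.
have tI : trivIset [set: 'I_n] (fun i => `]c i, d i[%classic : set R).
  move=> i j _ _ [x [xi xj]]; apply/eqP; apply: contraT => ij.
  by have := dis i j ij => /seteqP[+ _] => /(_ x (conj xi xj)).
apply: (@le_trans _ _ (mu (\big[setU/set0]_(i < n) `]c i, d i[%classic))).
  rewrite measure_bigsetU_ord//.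
  have -> : (\sum_(i < n) mu `]c i, d i[ = \sum_(i < n) (d i - c i)%:E)%E.
    apply: eq_bigr => i _; rewrite lebesgue_measure_itv/= lte_fin.
    by case: ltgtP (cd i) => //= -> _; rewrite subrr.
  by rewrite sumEFin.
rewrite le_measure ?inE//; first by apply: bigsetU_measurable.
by elim/big_ind: _ => [//|A B AU BU x [/AU|/BU]//|i _ //]; exact: sub.
Qed.

End AbsoluteContinuity.

(** * Monotonicity from an almost everywhere derivative *)

Section Monotonicity.
Context {R : realType}.
Notation mu := (@lebesgue_measure R).

(** The supremum of the points reached from a can be reached as well, and then
    passed unless it is b: the local hypothesis carries P from slightly before
    any s to slightly after it. *)
Lemma sup_induction (P : R -> Prop) (a b : R) : a <= b -> P a ->
  (forall s, a <= s <= b -> exists2 r, 0 < r & forall u v,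
     a <= u -> s - r < u -> u <= s -> s <= v -> v < s + r -> v <= b ->
     P u -> P v) ->
  P b.
Proof.
move=> ab Pa loc; pose S := [set t | a <= t <= b /\ P t].
have Sa : S a by split=> //; rewrite lexx.
have ubS : ubound S b by move=> t [/andP[]].
have hS : has_sup S by split; [exists a|exists b].
have as_ : a <= sup S by apply: sup_upper_bound.
have sb : sup S <= b by apply: ge_sup => //; exists a.
have [|r r0 step] := loc (sup S); first by apply/andP.
have [u [/andP[au ub] Pu] su] := sup_adherent r0 hS.
have us : u <= sup S by apply: sup_upper_bound => //; split=> //; apply/andP.
have [bs|sb'] := leP b (sup S); first by apply: (step u) => //; lra.
pose v := Num.min b (sup S + r / 2).
have vb : v <= b by rewrite ge_min lexx.
have sv : sup S < v by rewrite lt_min sb'/=; lra.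
have vr : v <= sup S + r / 2 by rewrite ge_min lexx orbT.
have Sv : S v.
  split; first by apply/andP; lra.
  by apply: (step u) => //; lra.
have := sup_upper_bound hS Sv; lra.
Qed.

(** Cover the exceptional null set by an open set U of measure less than delta
    and sweep from a to b.  Off the null set the increase of f is locally at
    most e times the length travelled; inside U the sweep jumps over an
    interval and records the increment of f there.  The recorded intervals are
    disjoint and contained in U, so absolute continuity bounds the recorded
    increments by e in total. *)
Lemma abs_continuous_nonincreasing (a b : R) (f : R -> R) : a <= b ->
  abs_continuous a b f ->
  {ae mu, forall t, a < t < b -> exists2 df, is_derive t 1 f df & df <= 0} ->
  f b <= f a.
Proof.
move=> ab acf [N [mN N0 PN]].
apply/ler_addgt0Pr => eps eps0.
pose e := eps / (b - a + 1).
have e0 : 0 < e by apply: divr_gt0 => //; lra.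
have eE : e * (b - a) + e = eps by rewrite /e; field; apply/lt0r_neq0; lra.
have [delta delta0 acd] := acf _ e0.
(* The endpoints join the null set, since no derivative is assumed there. *)
pose N' := N `|` [set a] `|` [set b].
have mN' : measurable N' by apply: measurableU => //; apply: measurableU.
have N'0 : mu N' = 0%E.
  apply/eqP; rewrite eq_le measure_ge0 andbT.
  apply: (le_trans (measureU2 _ _ _)) => //; first exact: measurableU.
  rewrite [X in (_ + X)%E]lebesgue_measure_set1 adde0.
  apply: (le_trans (measureU2 _ _ _)) => //.
  by rewrite [X in (_ + X)%E]lebesgue_measure_set1 adde0 -N0.
have [U [oU N'U muUN]] : exists U : set R,
    [/\ open U, N' `<=` U & (mu (U `\` N') < delta%:E)%E].
  by apply: lebesgue_regularity_outer => //; rewrite [X in (X < _)%E]N'0.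
have mU : measurable U by exact: measurable_realfun.open_measurable.
have muU : (mu U < delta%:E)%E.
  apply: le_lt_trans muUN; rewrite -[leRHS]adde0 -[X in (_ <= _ + X)%E]N'0.
  rewrite [X in (X <= _)%E](_ : _ = mu ((U `\` N') `|` N')); last first.
    by rewrite setUC setDUK.
  by apply: measureU2 => //; exact: measurableD.
(* The intervals recorded so far form a finite increasing family in U. *)
pose good t := exists n (c d : nat -> R),
  [/\ forall i, (i < n)%N -> [/\ a <= c i, c i <= d i, d i <= t &
        `]c i, d i[ `<=` U],
      forall i j, (i < j < n)%N -> d i <= c j &
      f t - f a <= e * (t - a) + \sum_(i < n) `|f (d i) - f (c i)|].
suff [n [c [d [cd dis fle]]]] : good b.
  have dis' (i j : 'I_n) : i != j -> `]c i, d i[ `&` `]c j, d j[ = set0.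
    move=> ij; wlog lij : i j ij / (i < j)%N.
      move=> H; have := ij; rewrite neq_ltn => /orP[ltij|ltji].
        exact: H.
      by rewrite setIC; apply: H => //; rewrite eq_sym.
    apply/seteqP; split=> // y [] /=; rewrite !in_itv/= => /andP[_ h1] /andP[h2 _].
    have := dis i j; rewrite lij ltn_ord => /(_ isT); lra.
  have lt : \sum_(i < n) (d i - c i) < delta.
    rewrite -lte_fin; apply: le_lt_trans muU.
    apply: mu_disjoint_intervals_le => //.
      by move=> i; have [] := cd i (ltn_ord i).
    by move=> i; have [] := cd i (ltn_ord i).
  have := acd n (fun i => c i) (fun i => d i) _ dis' lt.
  have H (i : 'I_n) : a <= c i /\ c i <= d i /\ d i <= b.
    by have [] := cd i (ltn_ord i).
  move=> /(_ H) lte; rewrite -lerBlDl (le_trans fle)// -eE lerD2l.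
  exact: ltW.
have good_flat u v : u <= v -> f v - f u <= e * (v - u) -> good u -> good v.
  move=> uv fuv [n [c [d [cd dis fle]]]]; exists n, c, d; split=> //.
    move=> i /cd[h1 h2 h3 h4]; split=> //; lra.
  move: fle; set S := \sum_(i < n) _ => fle; lra.
have good_jump u v : a <= u -> u <= v -> `]u, v[ `<=` U -> good u -> good v.
  move=> au uv uvU [n [c [d [cd dis fle]]]].
  exists n.+1, (fun i => if (i < n)%N then c i else u),
    (fun i => if (i < n)%N then d i else v); split.
  - move=> i _; case: ifPn => // /cd[h1 h2 h3 h4]; split=> //; lra.
  - move=> i j /andP[ij jn].
    have ni : (i < n)%N by apply: leq_trans ij _.
    rewrite ni; case: ifPn => jn'; first by apply: dis; rewrite ij.
    by have [] := cd i ni.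
  - rewrite big_ord_recr/= ltnn; under eq_bigr do rewrite ltn_ord.
    move: fle; set S := \sum_(i < n) _ => fle.
    have := ler_norm (f v - f u).
    have : 0 <= e * (v - u) by apply: mulr_ge0; lra.
    lra.
apply: (@sup_induction good a b) => //.
  exists 0%N, (fun=> 0), (fun=> 0); split=> [//|i j|].
    by rewrite ltn0 andbF.
  by rewrite big_ord0 !subrr mulr0 addr0.
move=> s /andP[as_ sb]; have [Us|Us] := pselect (U s).
  have [r /= r0 rU] := (oU : forall x, U x -> nbhs x U) s Us.
  exists r => // u v au su us sv vs vb; apply: good_jump => //; first lra.
  move=> y /=; rewrite in_itv/= => /andP[uy yv]; apply: rU => /=.
  by rewrite ltr_norml; apply/andP; lra.
have asb : a < s < b.
  rewrite !lt_neqAle as_ sb !andbT; apply/andP; split; apply/eqP => E; apply: Us;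
    apply: N'U; rewrite /N' -?E; [left; right|right]; by [].
have [df dfs df0] : exists2 df, is_derive s 1 f df & df <= 0.
  by apply: contrapT => H; apply: Us; apply: N'U; left; left; apply: PN => /= /(_ asb).
have [r r0 loc] := is_derive_le_local dfs (le_lt_trans df0 e0).
exists r => // u v au su us sv vs vb gu.
apply: (good_flat s) => //.
  by have [|h _] := loc v; [rewrite ger0_norm; lra|exact: h].
apply: (good_flat u) => //.
by have [|_ h] := loc u; [rewrite ler0_norm; lra|exact: h].
Qed.

End Monotonicity.

(** * Power means and subgradients along a line *)

Section PowerMean.
Context {R : realType}.
Implicit Types (p : R).

(** Young's inequality for r * 1 with exponents p and p / (p - 1). *)
Lemma powR_bernoulli p (r : R) : 1 <= p -> 0 <= r -> 1 + p * (r - 1) <= r `^ p.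
Proof.
rewrite le_eqVlt => /predU1P[<- r0|p1 r0]; first by rewrite powRr1//; lra.
have p0 : 0 < p by lra.
have q0 : 0 < p / (p - 1) by apply: divr_gt0; lra.
have := @conjugate_powR _ r 1 p (p / (p - 1)) r0 ler01 p0 q0.
rewrite powR1 => /(_ _)/wrap[].
  by field; rewrite ?subr_eq0 ?gt_eqF.
move=> h; have := ler_wpM2l (ltW p0) h.
rewrite mulr1 mulrDr mulrCA divff ?gt_eqF// mulr1.
rewrite (_ : p * (1 / _) = p - 1); first lra.
by field; rewrite ?subr_eq0 ?gt_eqF.
Qed.

(** Jensen's inequality for the convex function r `^ p. *)
Lemma sum_powR_le (I : eqType) (r : seq I) (f : I -> R) p : 1 <= p ->
  (forall i, 0 <= f i) ->
  (\sum_(i <- r) f i) `^ p <= (size r)%:R `^ (p - 1) * \sum_(i <- r) f i `^ p.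
Proof.
move=> p1 f0; have p0 : 0 < p by lra.
set s := \sum_(i <- r) f i.
have s0 : 0 <= s by apply: sumr_ge0.
have S0 : 0 <= \sum_(i <- r) f i `^ p by apply: sumr_ge0 => i _; exact: powR_ge0.
have [->|sn0] := eqVneq s 0.
  by rewrite powR0 ?gt_eqF// mulr_ge0// powR_ge0.
have sp : 0 < s by rewrite lt_neqAle eq_sym sn0.
have n0 : 0 < (size r)%:R :> R.
  by rewrite ltr0n lt0n; apply: contra_neq sn0 => /size0nil E; rewrite /s E big_nil.
set n := (size r)%:R in n0 *.
have A0 : 0 < s / n by apply: divr_gt0.
(* The tangent at the mean s / n is used: its linear part sums to 0 over r. *)
have tangent i : (s / n) `^ p * (1 + p * (f i / (s / n) - 1)) <= f i `^ p.
  have -> : f i `^ p = (s / n) `^ p * (f i / (s / n)) `^ p.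
    rewrite -powRM ?divr_ge0// ?ltW//; congr (_ `^ _).
    by rewrite mulrCA divff ?mulr1// gt_eqF.
  apply: ler_wpM2l; first exact: powR_ge0.
  by apply: powR_bernoulli => //; rewrite divr_ge0// ltW.
have : n * (s / n) `^ p <= \sum_(i <- r) f i `^ p.
  apply: le_trans (ler_sum _ (fun i _ => tangent i)).
  rewrite -mulr_sumr big_split/= -mulr_sumr big_split/= sumrN -mulr_suml.
  rewrite big_const_seq count_predT iter_addr addr0 -/s -/n.
  have -> : s / (s / n) = n by rewrite invf_div mulrCA divff ?mulr1 ?gt_eqF.
  by rewrite subrr mulr0 addr0 mulrC.
move=> /(ler_wpM2l (powR_ge0 n (p - 1))); apply: le_trans.
rewrite mulrA [_ * n]mulrC mulr_powRB1 ?(ltW n0)//.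
by rewrite -powRM ?(ltW n0) ?(ltW A0)// mulrCA divff ?gt_eqF// mulr1.
Qed.

End PowerMean.

Section Subdifferential.
Context {R : realType} {V : finType}.
Implicit Types (x y z d : V -> R) (phi : (V -> R) -> R).

Lemma dotpZr z (s : R) d : dotp z (fun v => s * d v) = s * dotp z d.
Proof. by rewrite /dotp mulr_sumr; apply: eq_bigr => v _; rewrite mulrCA. Qed.

(** Along the line x + s d, phi minus its supporting affine function is
    nonnegative and vanishes at s = 0, so its derivative there is 0. *)
Lemma subdifferential_derive phi x z d (h : R -> R) (k : R) :
  subdifferential phi x z ->
  (forall s, s \in `]-1, 1[%R -> phi (fun v => x v + s * d v) = h s) ->
  (forall s, s \in `]-1, 1[%R -> derivable h s 1) ->
  is_derive (0 : R) 1 h k ->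
  dotp z d = k.
Proof.
move=> zx phih dh dh0.
have in0 : (0 : R) \in `]-1, 1[%R by rewrite in_itv/= ltr01 andbT; lra.
pose g s := h s - dotp z d * s.
have gmin s : s \in `]-1, 1[%R -> g 0 <= g s.
  move=> s11; rewrite /g -!phih//.
  have := zx (fun v => x v + s * d v).
  rewrite (_ : (fun v => x v + s * d v - x v) = (fun v => s * d v)); last first.
    by apply/funext => v; ring.
  rewrite dotpZr.
  rewrite (_ : (fun v => x v + 0 * d v) = x); last first.
    by apply/funext => v; ring.
  lra.
have dg0 : is_derive (0 : R) 1 g (k - dotp z d).
  by rewrite -[dotp z d in X in is_derive _ _ _ X]mulr1; apply: is_deriveB.
have : is_derive (0 : R) 1 g 0.
  have N11 : (-1 : R) <= 1 by lra.
  apply: (@derive1_at_min R g (-1) 1 0 N11 _ in0 gmin).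
  by move=> s s11; apply: derivableB; [exact: dh|exact: ex_derive].
by move=> /@derive_val; rewrite derive_val => /eqP; rewrite subr_eq0 => /eqP.
Qed.

End Subdifferential.

(** * Energy and connected components *)

Section EdgeMax.
Context {R : realType} {V : finType}.
Implicit Types (e : {set V}) (x y : V -> R).

Lemma edge_max_ge0 e x : 0 <= edge_max e x.
Proof. exact: bigmax_ge_id. Qed.

Lemma le_edge_max e x u v : u \in e -> v \in e -> x u - x v <= edge_max e x.
Proof.
move=> ue ve; apply: le_trans (le_bigmax_cond _ _ ue).
exact: (le_bigmax_cond _ (fun v => x u - x v) ve).
Qed.

Lemma edge_max_scale (k : R) e x y : 0 <= k ->
  (forall u v, u \in e -> v \in e -> y u - y v = k * (x u - x v)) ->
  edge_max e y = k * edge_max e x.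
Proof.
move=> k0 yx.
have kmax : {morph (fun r => k * r) : r s / Num.max r s}.
  by move=> r s; exact: maxr_pMr.
rewrite /edge_max (big_morph _ kmax (mulr0 k)); apply: eq_bigr => u ue.
rewrite (big_morph _ kmax (mulr0 k)); apply: eq_bigr => v ve; exact: yx.
Qed.

End EdgeMax.

Section Energy.
Context {R : realType} {V : finType}.
Variable G : weighted_hypergraph R V.
Implicit Types (x y z : V -> R) (p : R).

Definition constant_on_edges y :=
  forall e u v, e \in edges G -> u \in e -> v \in e -> y u = y v.

(** The energy only sees differences inside edges: homogeneity and invariance
    under functions constant on edges in one identity. *)
Lemma energy_scale p (k : R) x y : 0 <= k ->
  constant_on_edges (fun v => y v - k * x v) ->
  energy G p y = k `^ p * energy G p x.
Proof.
move=> k0 yx; rewrite /energy mulrCA; congr (_ * _).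
rewrite mulr_sumr; apply: eq_bigr => e eG.
rewrite (@edge_max_scale _ _ k e x y k0) ?powRM ?edge_max_ge0 1?mulrCA//.
by move=> u v ue ve; have := yx e u v eG ue ve; lra.
Qed.

Lemma pLaplacian_orthogonal p x z d : pLaplacian G p x z ->
  constant_on_edges d -> dotp z d = 0.
Proof.
move=> zx dG; apply: (subdifferential_derive zx (h := fun=> energy G p x)).
- move=> s _; rewrite (@energy_scale _ 1 x) ?powR1 ?mul1r// => e u v eG ue ve.
  by rewrite (dG e u v)//; ring.
- by move=> s _; exact: derivable_cst.
Qed.

(** Euler's identity: s |-> energy (x + s (x - m)) is (1 + s) `^ p * energy x. *)
Lemma pLaplacian_euler p x m z : p != 0 -> pLaplacian G p x z ->
  constant_on_edges m ->
  dotp z (fun v => x v - m v) = p * energy G p x.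
Proof.
move=> p0 zx mG.
have d1 (s : R) : - 1 < s ->
    is_derive s 1 (fun s => (1 + s) `^ p) (p * (1 + s) `^ (p - 1)).
  move=> s1; have s1' : 0 < 1 + s by lra.
  have dadd : is_derive s 1 (fun s => 1 + s) 1.
    by rewrite -[X in is_derive _ _ _ X]add0r; apply: is_deriveD.
  have := @is_derive1_comp R (fun r : R => r `^ p) (fun s => 1 + s) s _ _
     (@is_derive1_powR R p _ s1') dadd.
  by rewrite mulr1.
apply: (subdifferential_derive zx
    (h := fun s => (1 + s) `^ p * energy G p x)).
- move=> s; rewrite in_itv/= => /andP[s1 _].
  rewrite (@energy_scale _ (1 + s) x)//; first lra.
  by move=> e u v eG ue ve; have := mG e u v eG ue ve => ->; ring.
- move=> s; rewrite in_itv/= => /andP[s1 _].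
  have ? := d1 s s1.
  by apply: derivableM => //; apply: ex_derive.
- have N10 : - 1 < 0 :> R by lra.
  have := d1 0 N10; rewrite addr0 powR1 mulr1 => d0.
  have := @is_deriveM _ _ _ (fun=> energy G p x) _ _ _ _ d0 (is_derive_cst _ _ _).
  by rewrite scaler0 add0r [_ *: _]mulrC.
Qed.

End Energy.

Section Components.
Context {R : realType} {V : finType}.
Variable G : weighted_hypergraph R V.
Implicit Types (x : V -> R) (S : {set V}) (p : R).

Lemma connect_share_edge_equivalence :
  {in [set: V]%SET & &, equivalence_rel (connect (share_edge G))}.
Proof.
have sym : connect_sym (share_edge G).
  apply: sym_connect_sym => u v.
  by apply: eq_existsb => e; rewrite [(u \in e) && _]andbC.
move=> u v w _ _ _; split; first exact: connect0.
by move=> uv; apply/idP/idP; apply: connect_trans; rewrite // sym.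
Qed.

Lemma components_partition : finset.partition (components G) [set: V]%SET.
Proof. exact: finset.equivalence_partitionP connect_share_edge_equivalence. Qed.

Lemma component_connect S u v : S \in components G -> u \in S ->
  (v \in S) = connect (share_edge G) u v.
Proof.
move=> SG uS; have [_ tiP _] := and3P components_partition.
rewrite -(def_pblock tiP SG uS).
by rewrite (pblock_equivalence_partition connect_share_edge_equivalence).
Qed.

Lemma sum_components (F : V -> R) :
  \sum_v F v = \sum_(S in components G) \sum_(v in S) F v.
Proof.
by rewrite -(set_partition_big _ components_partition); apply: eq_bigl => v; rewrite inE.
Qed.

Lemma component_mean_block x S v : S \in components G -> v \in S ->
  component_mean G x v = mean S x.
Proof.
move=> SG vS; have [_ tiP _] := and3P components_partition.
rewrite /component_mean (bigD1 S)//= vS mulr1 big1 ?addr0// => S' /andP[S'G S'S].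
have [vS'|_] := boolP (v \in S'); last by rewrite mulr0.
by move: S'S; rewrite -(def_pblock tiP SG vS) -(def_pblock tiP S'G vS') eqxx.
Qed.

Lemma edge_component e u v S : e \in edges G -> u \in e -> v \in e ->
  S \in components G -> (u \in S) = (v \in S).
Proof.
have H u' v' : e \in edges G -> u' \in e -> v' \in e ->
    S \in components G -> u' \in S -> v' \in S.
  move=> eG ue ve SG uS; rewrite (component_connect _ SG uS); apply: connect1.
  by apply/existsP; exists e; rewrite eG ue.
by move=> eG ue ve SG; apply/idP/idP; apply: H.
Qed.

Lemma component_mean_constant_on_edges x :
  constant_on_edges G (component_mean G x).
Proof.
move=> e u v eG ue ve; apply: eq_bigr => S SG.
by rewrite (edge_component eG ue ve SG).
Qed.

Lemma indicator_constant_on_edges S : S \in components G ->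
  constant_on_edges G (fun v => (v \in S)%:R).
Proof. by move=> SG e u v eG ue ve; rewrite (edge_component eG ue ve SG). Qed.

Definition incident : rel (V + {set V}) := fun a b =>
  match a, b with
  | inl v, inr e | inr e, inl v => (e \in edges G) && (v \in e)
  | _, _ => false
  end.

Definition vertex_of (a : V + {set V}) := if a is inl v then Some v else None.
Definition edge_of (a : V + {set V}) := if a is inr e then Some e else None.

(** Passing to the bipartite incidence graph makes a simple path repeat neither
    a vertex nor an edge; a simple path for [share_edge] could use the same
    edge several times. *)
Lemma connect_incident u v : connect (share_edge G) u v ->
  connect incident (inl u) (inl v).
Proof.
move=> /connectP[p + ->]; elim: p u => [|w p IHp] u /=.
  by move=> _; exact: connect0.
move=> /andP[/existsP[e /and3P[eG ue we]] /IHp]; apply: connect_trans.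
apply: (@connect_trans _ _ (inr e)); apply: connect1; rewrite /incident eG//.
Qed.

(** The path alternates between vertices and edges, so it meets as many edges
    as vertices after its origin, and the difference of x telescopes along its
    vertices. *)
Lemma incident_path_bound x u v (p : seq (V + {set V})) :
  path incident (inl u) p -> last (inl u) p = inl v ->
  [/\ size (pmap edge_of p) = size (pmap vertex_of p),
      {subset pmap edge_of p <= edges G},
      {subset pmap vertex_of p <= connect (share_edge G) u} &
      `|x u - x v| <= \sum_(e <- pmap edge_of p) edge_max e x].
Proof.
have [n] := ubnP (size p); elim: n p u => // n IHn [|a [|b p]] u.
- by move=> _ _ [->]; rewrite big_nil subrr normr0.
- by move=> _; case: a => //= e.
case: a => [w'|e] //; case: b => [w|e'] //=; rewrite ?andbF//=.

rewrite !ltnS => /ltnW sp /and3P[/andP[eG ue] /andP[_ we] pp] lp.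
have [-> sube subv le] := IHn p w sp pp lp; split => //.
- by move=> e1; rewrite inE => /predU1P[->//|]; exact: sube.
- have uw : connect (share_edge G) u w.
    by apply: connect1; apply/existsP; exists e; rewrite eG ue.
  move=> w1; rewrite inE => /predU1P[->//|/subv]; exact: connect_trans.
- rewrite big_cons (_ : x u - x v = (x u - x w) + (x w - x v)); last ring.
  apply: (le_trans (ler_normD _ _)); apply: lerD => //.
  by rewrite ler_norml lerNl opprB !le_edge_max.
Qed.

(** On a simple path the edges are distinct, hence their terms occur in the sum
    over all edges; their number is that of distinct vertices of S. *)
Lemma component_osc x S u v p : 1 <= p -> S \in components G ->
  u \in S -> v \in S ->
  `|x u - x v| `^ p <=
    #|S|%:R `^ (p - 1) * \sum_(e in edges G) edge_max e x `^ p.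
Proof.
move=> p1 SG uS vS.
have : connect (share_edge G) u v by rewrite -(component_connect _ SG uS).
move=> /connect_incident/connectP[q0 /shortenP[q pq uq _] lq].
have [sz sube subv le] := incident_path_bound x pq (esym lq).
have uq' : uniq q by case/andP: uq.
set es := pmap edge_of q in sz sube le.
have ues : uniq es.
  by rewrite /es (@pmap_uniq _ _ _ (fun e => inr e))// => -[].
have uvs : uniq (pmap vertex_of q).
  by rewrite (@pmap_uniq _ _ _ (fun v => inl v))// => -[].
have size_le : (size es <= #|S|)%N.
  rewrite sz -(card_uniqP uvs); apply: subset_leq_card; apply/fintype.subsetP => w /subv.
  by rewrite (component_connect _ SG uS).
have p0 : 0 <= p by lra.
apply: (@le_trans _ _ ((\sum_(e <- es) edge_max e x) `^ p)).
  by apply: ge0_ler_powR; rewrite ?nnegrE// sumr_ge0// => e _; exact: edge_max_ge0.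
apply: (le_trans (sum_powR_le es p1 (fun e => edge_max_ge0 e x))).
have f0 e : 0 <= edge_max e x `^ p by exact: powR_ge0.
apply: ler_pM; rewrite ?powR_ge0 ?sumr_ge0//.
  by apply: ge0_ler_powR; rewrite ?nnegrE ?ler0n ?ler_nat//; lra.
rewrite big_uniq//= big_mkcond [leRHS]big_mkcond/=; apply: ler_sum => e _.
by case: ifP => [/sube ->//|_]; case: ifP.
Qed.

End Components.

(** * The Poincare inequality *)

Section Poincare.
Context {R : realType} {V : finType}.
Variable G : weighted_hypergraph R V.
Implicit Types (x d : V -> R) (S : {set V}) (p : R).

Lemma dist_mean_le S x v (K : R) : v \in S ->
  (forall u, u \in S -> `|x v - x u| <= K) -> `|x v - mean S x| <= K.
Proof.
move=> vS xK; have S0 : 0 < #|S|%:R :> R.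
  by rewrite ltr0n card_gt0; apply/set0Pn; exists v.
have -> : x v - mean S x = #|S|%:R^-1 * \sum_(u in S) (x v - x u).
  rewrite sumrB sumr_const mulrBr -[x v *+ _]mulr_natl mulrA mulVf ?gt_eqF//.
  by rewrite mul1r.
rewrite normrM ger0_norm ?invr_ge0 ?ler0n// mulrC ler_pdivrMr//.
apply: (le_trans (ler_norm_sum _ _ _)); rewrite mulr_natr -sumr_const.
exact: ler_sum.
Qed.

Lemma dotp_le_sqr_sum d : dotp d d <= (\sum_v `|d v|) ^+ 2.
Proof.
rewrite expr2 mulr_suml; apply: ler_sum => v _.
rewrite -expr2 -real_normK ?num_real// expr2; apply: ler_wpM2l => //.
by rewrite (bigD1 v)//= lerDl sumr_ge0.
Qed.

Lemma dotp_ge0 d : 0 <= dotp d d.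
Proof. by apply: sumr_ge0 => v _; rewrite -expr2 sqr_ge0. Qed.

Lemma min_weight_le e : e \in edges G -> min_weight G <= weight G e.
Proof.
move=> eG; apply: ge_inf; last by exists e.
by exists 0 => _ [e' /= /weight_gt0/ltW ? <-].
Qed.

Lemma min_weight_gt0 : edges G <> finset.set0 -> 0 < min_weight G.
Proof.
move=> /eqP/set0Pn[e0 e0G].
(* The infimum is positive because the smallest weight bounds it from below. *)
case: (arg_minP (weight G) e0G) => e eG emin.
apply: (lt_le_trans (weight_gt0 eG)); apply: lb_le_inf.
  by exists (weight G e0), e0.
by move=> _ [e' /= e'G <-]; exact: emin.
Qed.

Lemma energy_ge0 p x : 0 < p -> 0 <= energy G p x.
Proof.
move=> p0; rewrite mulr_ge0 ?invr_ge0 ?(ltW p0)// sumr_ge0// => e eG.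
by rewrite mulr_ge0 ?powR_ge0// ltW// weight_gt0.
Qed.

Lemma decay_const_ge0 p : edges G <> finset.set0 -> 0 <= decay_const G p.
Proof. by move=> /min_weight_gt0/ltW ?; rewrite mulr_ge0 ?invr_ge0 ?powR_ge0. Qed.

(** At a vertex of S the deviation from the mean is at most the oscillation of
    x over S, bounded by #|S| `^ (1 - 1 / p) times the l^p norm of the edge
    oscillations; the #|S| vertices of S give one more factor #|S|. *)
Lemma sum_dist_component_mean_le p x : 1 <= p ->
  \sum_v `|x v - component_mean G x v| <=
    (\sum_(S in components G) #|S|%:R `^ (2 - p^-1)) *
    (\sum_(e in edges G) edge_max e x `^ p) `^ p^-1.
Proof.
move=> p1; have p0 : 0 < p by lra.
set Q := \sum_(e in edges G) _.
have Q0 : 0 <= Q by apply: sumr_ge0 => e _; exact: powR_ge0.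
rewrite (sum_components G) mulr_suml; apply: ler_sum => S SG.
have -> : #|S|%:R `^ (2 - p^-1) * Q `^ p^-1 =
    \sum_(v in S) (#|S|%:R `^ (1 - p^-1) * Q `^ p^-1).
  rewrite sumr_const -[RHS]mulr_natl mulrA; congr (_ * _).
  have ip : p^-1 <= 1 by rewrite invf_le1.
  rewrite -(@mulr_powRB1 _ _ (2 - p^-1)) ?ler0n//; last lra.
  by congr (_ * _ `^ _); lra.
apply: ler_sum => v vS; rewrite (component_mean_block _ SG vS).
apply: dist_mean_le => // u uS.
have := component_osc x p1 SG vS uS; rewrite -/Q => h.
have ip0 : 0 <= p^-1 by rewrite invr_ge0 ltW.
have := ge0_ler_powR ip0 _ _ h; rewrite !nnegrE.
rewrite powR_ge0 mulr_ge0 ?powR_ge0// => /(_ isT isT).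
rewrite -powRrM divff ?gt_eqF// powRr1 ?normr_ge0//.
rewrite powRM ?powR_ge0// -powRrM mulrBl divff ?gt_eqF// mul1r.
by [].
Qed.

(** The l^2 norm is bounded by the l^1 norm, and the weights from below by
    [min_weight]. *)
Lemma poincare p x : edges G <> finset.set0 -> 1 <= p ->
  l2norm (fun v => x v - component_mean G x v) `^ p <=
    decay_const G p * (p * energy G p x).
Proof.
move=> E0 p1; have p0 : 0 < p by lra.
have w0 := min_weight_gt0 E0.
have := sum_dist_component_mean_le x p1.
rewrite /decay_const; set B := \sum_(S in _) _; set Q := \sum_(e in _) _ => le.
have Q0 : 0 <= Q by apply: sumr_ge0 => e _; exact: powR_ge0.
have B0 : 0 <= B by apply: sumr_ge0 => S _; exact: powR_ge0.
set A := \sum_v `|x v - component_mean G x v| in le.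
have A0 : 0 <= A by apply: sumr_ge0.
apply: (@le_trans _ _ (A `^ p)).
  apply: ge0_ler_powR; rewrite ?nnegrE ?sqrtr_ge0 ?(ltW p0)//.
  rewrite -(@ler_pXn2r _ 2) ?nnegrE ?sqrtr_ge0// sqr_sqrtr ?dotp_ge0//.
  exact: dotp_le_sqr_sum.
apply: (@le_trans _ _ (B `^ p * Q)).
  have -> : B `^ p * Q = (B * Q `^ p^-1) `^ p.
    by rewrite powRM ?powR_ge0// -powRrM mulVf ?gt_eqF// powRr1.
  by apply: ge0_ler_powR; rewrite ?nnegrE ?mulr_ge0 ?powR_ge0// ltW.
rewrite mulrAC mulrC; apply: ler_wpM2r; first exact: powR_ge0.
rewrite [leRHS]mulrC ler_pdivlMr// mulr_suml /energy mulrA divff ?gt_eqF// mul1r.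
apply: ler_sum => e eG; rewrite mulrC; apply: ler_wpM2r; first exact: powR_ge0.
exact: min_weight_le.
Qed.

End Poincare.

(** * Decay of solutions *)

Section DecayComparison.
Context {R : realType}.
Notation mu := (@lebesgue_measure R).

Lemma lebesgue_ae_imply (P Q : R -> Prop) : (forall t, P t -> Q t) ->
  {ae mu, forall t, P t} -> {ae mu, forall t, Q t}.
Proof.
move=> PQ [N [mN N0 PN]]; exists N; split=> // t nQt; apply: PN.
by move=> Pt; exact/nQt/PQ.
Qed.

Lemma is_derive_bigsum (I : Type) (r : seq I) (P : pred I) (f : I -> R -> R)
    (df : I -> R) (t : R) :
  (forall i, is_derive t 1 (f i) (df i)) ->
  is_derive t 1 (fun s => \sum_(i <- r | P i) f i s) (\sum_(i <- r | P i) df i).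
Proof.
move=> fdf; elim: r => [|i r IHr].
  under eq_fun do rewrite big_nil.
  by rewrite big_nil; exact: is_derive_cst.
under eq_fun do rewrite big_cons.
by rewrite big_cons; case: (P i) => //; exact: is_deriveD.
Qed.

(** Away from 0 the derivative r `^ (- q) is bounded by its value at r0. *)
Lemma lipschitz_of_derive (H : R -> R) (q r0 : R) : 0 <= q -> 0 < r0 ->
  (forall r : R, 0 < r -> is_derive r 1 H (r `^ (- q))) ->
  forall r s, r0 <= r -> r0 <= s -> `|H r - H s| <= r0 `^ (- q) * `|r - s|.
Proof.
move=> q0 r00 dH r s; wlog rs : r s / s <= r.
  move=> W rr sr; have [rs|/ltW rs] := leP s r; first exact: W.
  by rewrite distrC [`|r - s|]distrC; exact: W.
move=> rr sr; have [||c] := @MVT_segment _ H (fun r => r `^ (- q)) s r rs.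
- by move=> y; rewrite in_itv/= => /andP[? _]; apply: dH; lra.
- apply: derivable_within_continuous => y; rewrite in_itv/= => /andP[? _].
  by have ? : is_derive y 1 H (y `^ (- q)); [apply: dH; lra|exact: ex_derive].
rewrite in_itv/= => /andP[sc _] ->.
rewrite normrM; apply: ler_wpM2r => //.
rewrite ger0_norm ?powR_ge0// !powRN lef_pV2 ?posrE ?powR_gt0//; last lra.
by apply: ge0_ler_powR; rewrite ?nnegrE//; lra.
Qed.

(** Integration of the differential inequality X' <= - k X `^ q by separation of
    variables, with H an antiderivative of r `^ (- q).  X does not increase, so
    X t > 0 keeps X in the domain [X t, +oo[ where H is Lipschitz. *)
Lemma decay_comparison (X H : R -> R) (T k q : R) : 0 <= k -> 0 <= q ->
  (forall s, 0 <= X s) -> abs_continuous 0 T X ->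
  {ae mu, forall s, 0 < s < T ->
     exists2 dX, is_derive s 1 X dX & dX <= - k * X s `^ q} ->
  (forall r : R, 0 < r -> is_derive r 1 H (r `^ (- q))) ->
  forall t, 0 <= t <= T ->
    X t <= X 0 /\ (0 < X t -> H (X t) <= H (X 0) - k * t).
Proof.
move=> k0 q0 X0 acX aeX dH.
have mono s t : 0 <= s -> s <= t -> t <= T -> X t <= X s.
  move=> s0 st tT; apply: abs_continuous_nonincreasing => //.
    exact: abs_continuousS acX.
  apply: lebesgue_ae_imply aeX => r Hr /andP[sr rt].
  have [|dX dXr dXle] := Hr; first by apply/andP; lra.
  exists dX => //; apply: (le_trans dXle).
  by rewrite mulNr oppr_le0 mulr_ge0// powR_ge0.
move=> t /andP[t0 tT]; split=> [|Xt0]; first exact: mono.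
have lip := lipschitz_of_derive q0 Xt0 dH.
pose F s := H (X s) + k * s.
have acF : abs_continuous 0 t F.
  apply: abs_continuousD; last exact: abs_continuous_linear.
  apply: (@abs_continuous_lipschitz_comp _ _ _ _ [set r | X t <= r] H _ _ lip).
    by move=> s /andP[s0 st]; exact: mono.
  exact: abs_continuousS acX.
suff : F t <= F 0 by rewrite /F mulr0 addr0; lra.
apply: abs_continuous_nonincreasing => //.
apply: lebesgue_ae_imply aeX => s Hs /andP[s0 st].
have [|dX dXs dXle] := Hs; first by apply/andP; lra.
have Xs0 : 0 < X s by apply: (lt_le_trans Xt0); apply: mono; lra.
exists (dX * X s `^ (- q) + k).
  apply: is_deriveD.
    by rewrite mulrC; exact: (@is_derive1_comp R H X s _ _ (dH _ Xs0) dXs).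
  by rewrite -[X in is_derive _ _ _ X]mulr1; exact: is_deriveZ.
have := ler_wpM2r (powR_ge0 (X s) (- q)) dXle.
rewrite -mulrA -powRD ?subrr ?powRr0; last by rewrite (gt_eqF Xs0) implybT.
lra.
Qed.

End DecayComparison.

Section Decay.
Context {R : realType} {V : finType}.
Variable G : weighted_hypergraph R V.
Notation mu := (@lebesgue_measure R).
Variables (p T : R) (x0 : V -> R) (x : R -> V -> R).
Hypotheses (E0 : edges G <> finset.set0) (p1 : 1 <= p).
Hypothesis solx : cauchy_solution (pLaplacian G p) T x0 x.

(** Since x' is orthogonal to the indicator of S, both the sum over S and its
    opposite have zero derivative almost everywhere, so neither increases. *)
Lemma cauchy_solution_mean S t : S \in components G -> 0 <= t <= T ->
  mean S (x t) = mean S x0.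
Proof.
move=> SG /andP[t0 tT]; have [acx <- aex] := solx.
rewrite /mean; congr (_ * _); apply/eqP; rewrite eq_le.
have ac (k : R) : abs_continuous 0 t (fun s => k * \sum_(v in S) x s v).
  apply: (@abs_continuous_lipschitz_comp _ _ _ _ setT ( *%R k) `|k|) => //.
    by move=> r s _ _; rewrite -mulrBr normrM.
  by apply: abs_continuous_sum => v; apply: abs_continuousS (acx v).1.
have cst (k : R) : k * (\sum_(v in S) x t v) <= k * (\sum_(v in S) x 0 v).
  apply: (abs_continuous_nonincreasing t0 (ac k)).
  apply: lebesgue_ae_imply aex => s Hs /andP[s0 st].
  have [|x' [dx Lx]] := Hs; first by apply/andP; lra.
  have dS : \sum_(v in S) x' v = 0.
    rewrite big_mkcond/=.
    have := pLaplacian_orthogonal Lx (indicator_constant_on_edges SG).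
    rewrite /dotp/=; under eq_bigr do rewrite mulNr.
    move=> /eqP; rewrite sumrN oppr_eq0 => /eqP sum0.
    rewrite -[RHS]sum0; apply: eq_bigr => v _.
    by case: (v \in S); rewrite ?mulr1 ?mulr0.
  exists 0 => //; have := is_deriveZ k (is_derive_bigsum (enum S) xpredT dx).
  by under eq_fun do rewrite big_enum; rewrite big_enum dS scaler0.
by have := cst 1; have := cst (-1); rewrite !mul1r !mulN1r lerN2 => -> ->.
Qed.

Lemma cauchy_solution_component_mean t : 0 <= t <= T ->
  component_mean G (x t) = component_mean G x0.
Proof.
move=> tT; apply/funext => v; apply: eq_bigr => S SG.
by rewrite (cauchy_solution_mean SG tT).
Qed.

Let X t := l2norm (fun v => x t v - component_mean G x0 v) ^+ 2.

Lemma sqr_distE t : X t = \sum_v (x t v - component_mean G x0 v) ^+ 2.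
Proof. by rewrite /X sqr_sqrtr ?dotp_ge0. Qed.

Lemma sqr_dist_abs_continuous : 0 <= T -> abs_continuous 0 T X.
Proof.
move=> T0; have [acx _ _] := solx.
rewrite (_ : X = fun t => \sum_v (x t v - component_mean G x0 v) ^+ 2); last first.
  by apply/funext => t; exact: sqr_distE.
apply: abs_continuous_sum => v; apply: abs_continuous_sqr => //.
apply: (@abs_continuous_lipschitz_comp _ _ _ _ setT (fun r => r - _) 1) => //.
  by move=> r s _ _; rewrite mul1r opprB addrA subrK.
exact: (acx v).1.
Qed.

(** Euler's identity computes X', and the Poincare inequality bounds it, the
    component mean of x t being that of x0. *)
Lemma sqr_dist_derive : {ae mu, forall t, 0 < t < T ->
  exists2 dX, is_derive t 1 X dX &
    dX <= - (2 / decay_const G p) * X t `^ (p / 2)}.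
Proof.
have [_ _ aex] := solx; apply: lebesgue_ae_imply aex => t Ht tT.
have [x' [dx Lx]] := Ht tT; have {tT} tT : 0 <= t <= T.
  by case/andP: tT => ? ?; apply/andP; lra.
set m := component_mean G x0.
exists (\sum_v 2 * (x t v - m v) * x' v).
  rewrite (_ : X = fun t => \sum_v (x t v - m v) ^+ 2); last first.
    by apply/funext => s; exact: sqr_distE.
  apply: is_derive_bigsum => v.
  have dxm : is_derive t 1 (fun s => x s v - m v) (x' v).
    by rewrite -[X in is_derive _ _ _ X]subr0; apply: is_deriveB.
  have := @is_deriveX _ _ (fun s => x s v - m v) 2 t 1 _ dxm.
  by rewrite /= expr1.
have p0 : 0 < p by have := p1; lra.
have mG : constant_on_edges G m by exact: component_mean_constant_on_edges.
have := pLaplacian_euler (lt0r_neq0 p0) Lx mG.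
rewrite /dotp/=; under eq_bigr do rewrite mulNr mulrC.
rewrite sumrN => euler.
have -> : \sum_v 2 * (x t v - m v) * x' v = - 2 * (p * energy G p (x t)).
  by rewrite -euler mulrNN mulr_sumr; apply: eq_bigr => v _; rewrite mulrA.
have := poincare (x t) E0 p1.
rewrite cauchy_solution_component_mean// -/m.
have -> : l2norm (fun v => x t v - m v) `^ p = X t `^ (p / 2).
  by rewrite /X -powR_mulrn ?sqrtr_ge0// -powRrM; congr (_ `^ _); field.
have := energy_ge0 G (x t) p0; have := decay_const_ge0 p E0.
set C := decay_const G p; set D := energy G p (x t) => C0 D0 le.
have pD : 0 <= p * D by rewrite mulr_ge0// ltW.
have : C^-1 * X t `^ (p / 2) <= p * D.
  move: C0; rewrite le_eqVlt => /predU1P[<-|C0]; first by rewrite invr0 mul0r.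
  by rewrite mulrC ler_pdivrMr// [leRHS]mulrC.
lra.
Qed.

Lemma sqr_dist_decay (H : R -> R) t : 0 <= t <= T ->
  (forall r : R, 0 < r -> is_derive r 1 H (r `^ (- (p / 2)))) ->
  X t <= X 0 /\ (0 < X t -> H (X t) <= H (X 0) - 2 / decay_const G p * t).
Proof.
move=> tT dH; have /andP[t0 tT'] := tT.
apply: (decay_comparison _ _ _ _ sqr_dist_derive dH tT) => //.
- by rewrite divr_ge0// decay_const_ge0.
- by have := p1; lra.
- by move=> s; exact: sqr_ge0.
- by apply: sqr_dist_abs_continuous; lra.
Qed.

End Decay.

Theorem theorem3p3 (R : realType) (V : finType) (G : weighted_hypergraph R V)
  (hE : edges G <> finset.set0) (p T : R) (hp : 1 <= p) (hT : 0 < T)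
  (x0 : V -> R) (x : R -> V -> R)
  (hx : cauchy_solution (pLaplacian G p) T x0 x) :
  let X := fun t : R => l2norm (fun v => x t v - component_mean G x0 v) ^+ 2 in
  let C := decay_const G p in
  forall t : R, 0 <= t <= T ->
  [/\ p < 2 ->
        X t <= Num.max (X 0 `^ ((2 - p) / 2) - (2 - p) * t / C) 0
                 `^ (2 / (2 - p)),
      p = 2 -> X t <= X 0 * expR (- (2 * t / C)) &
      2 < p ->
        X t <= if X 0 == 0 then 0
               else (X 0 `^ (- ((p - 2) / 2)) + (p - 2) * t / C)
                      `^ (- (2 / (p - 2)))].
Proof.
move=> X C t tT; have /andP[t0 _] := tT.
have Xge0 s : 0 <= X s by exact: sqr_ge0.
have C0 : 0 <= C^-1 by rewrite invr_ge0 decay_const_ge0.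
have decay H := sqr_dist_decay (H := H) hE hp hx tT.
rewrite -/X -/C in decay.
(* For p != 2 an antiderivative of r `^ (- p / 2) is a multiple of a power. *)
have decay_powR : p != 2 ->
    X t <= X 0 /\ (0 < X t -> (1 - p / 2)^-1 * X t `^ (1 - p / 2) <=
      (1 - p / 2)^-1 * X 0 `^ (1 - p / 2) - 2 * t / C).
  move=> p2; have q1 : 1 - p / 2 != 0.
    by apply: contra_neq p2 => ?; lra.
  rewrite [2 * t / C]mulrAC.
  apply: (decay (fun r => (1 - p / 2)^-1 * r `^ (1 - p / 2))) => r r0.
  have := is_deriveZ (1 - p / 2)^-1 (is_derive1_powR (1 - p / 2) r0).
  by rewrite /GRing.scale/= mulrA mulVf// mul1r addrAC subrr add0r.
have [Xt0|] := ltP 0 (X t); last first.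
  move=> Xt_le0; have -> : X t = 0 by apply/eqP; rewrite eq_le Xt_le0 Xge0.
  split=> [_|_|_]; first exact: powR_ge0.
    exact: mulr_ge0 (Xge0 0) (expR_ge0 _).
  by case: (X 0 == 0) => //; exact: powR_ge0.
split=> [p2|p2|p2].
- have [_ /(_ Xt0)] := decay_powR (negbT (lt_eqF p2)).
  have -> : 1 - p / 2 = (2 - p) / 2 by field.
  set q := (2 - p) / 2; have q0 : 0 < q by rewrite /q; lra.
  have -> : (2 - p) * t / C = q * (2 * t / C) by rewrite /q !mulrA divfK.
  have -> : 2 / (2 - p) = q^-1 by rewrite /q invf_div.
  move=> /(ler_wpM2l (ltW q0)); rewrite mulrBr !mulrA mulfV ?gt_eqF// !mul1r => le.
  have -> : X t = (X t `^ q) `^ q^-1.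
    by rewrite -powRrM mulfV ?gt_eqF// powRr1.
  apply: ge0_ler_powR; rewrite ?nnegrE ?powR_ge0 ?invr_ge0 ?(ltW q0)//.
    by rewrite le_max lexx orbT.
  by rewrite le_max; apply/orP; left; lra.
- have [X0t /(_ Xt0) le] : X t <= X 0 /\
      (0 < X t -> ln (X t) <= ln (X 0) - 2 / C * t).
    apply: decay => r r0; rewrite p2 divff// powR_inv1 ?(ltW r0)//.
    exact: is_derive1_ln.
  have X00 : 0 < X 0 by exact: lt_le_trans X0t.
  rewrite -[X t]lnK ?posrE// -[X in X * _]lnK ?posrE// -expRD ler_expR.
  by rewrite mulrAC.
- have [X0t /(_ Xt0)] := decay_powR (negbT (gt_eqF p2)).
  have X00 : 0 < X 0 by exact: lt_le_trans X0t.
  rewrite gt_eqF//.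
  have -> : 1 - p / 2 = - ((p - 2) / 2) by field.
  set q := (p - 2) / 2; have q0 : 0 < q by rewrite /q; lra.
  have -> : (p - 2) * t / C = q * (2 * t / C) by rewrite /q !mulrA divfK.
  have -> : 2 / (p - 2) = q^-1 by rewrite /q invf_div.
  move=> /(ler_wpM2l (ltW q0)); rewrite mulrBr !mulrA invrN mulrN mulfV ?gt_eqF//.
  rewrite !mulN1r => le.
  have tC0 : 0 <= q * 2 * t / C.
    by do 2! apply: mulr_ge0 => //; apply: mulr_ge0; rewrite ?(ltW q0).
  have Y0 : 0 < X 0 `^ (- q) + q * 2 * t / C by rewrite ltr_pwDl// powR_gt0.
  have -> : X t = (X t `^ (- q)) `^ (- q^-1).
    by rewrite -powRrM mulrNN mulfV ?gt_eqF// powRr1.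
  rewrite ![_ `^ (- q^-1)]powRN lef_pV2 ?posrE ?powR_gt0//.
  by apply: ge0_ler_powR; rewrite ?nnegrE ?powR_ge0 ?invr_ge0 ?(ltW q0) ?(ltW Y0)//; lra.
Qed.
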